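(* Let $n\in\mathbb N$, let $C$ be a compact Hausdorff right topological semigroup, let $\phi:S_n\to C$ be an $S_0$-independent homomorphism with $\phi[S_n]$ contained in the topological center of $C$, denote also by $\phi$ its continuous extension from $\beta S_n$ to $C$, and let $F$ be a finite nonempty set of $S_0$-preserving homomorphisms from $S_n$ into $S_0$. Let $P$ be the set of $p\in\phi[\beta S_n]$ such that for every neighborhood $U$ of $p$ and every piecewise syndetic subset $D$ of $S_0$ there exists $w\in S_n$ with $\phi(w)\in U$ and $\nu(w)\in D$ for all $\nu\in F$. Then $P$ is a compact subsemigroup of $C$ containing all the idempotents of $\phi[\beta S_n]$.
   Context: $\mathbb A$ is a fixed nonempty finite alphabet, $S_0=\mathbb A^+$ the free semigroup of nonempty words over $\mathbb A$, $S_n$ the set of nonempty words over $\mathbb A\cup\{v_1,\dots,v_n\}$ (distinct variables not in $\mathbb A$) in which each $v_i$ occurs. A homomorphism $\phi:S_n\to C$ is $S_0$-independent if $\phi(uw)=\phi(w)=\phi(wu)$ for $w\in S_n,u\in S_0$; a homomorphism $\nu:S_n\to S_0$ is $S_0$-preserving if $\nu(uw)=u\nu(w)$, $\nu(wu)=\nu(w)u$ for $u\in S_0,w\in S_n$. A semigroup with topology is right topological if each right translation $x\mapsto xs$ is continuous; the topological center is the set of $s$ for which $x\mapsto sx$ is continuous. For a discrete semigroup $X$, $\beta X$ is its Stone–Čech compactification (ultrafilters) with extended operation ($A\in pq$ iff $\{x:x^{-1}A\in q\}\in p$); maps from $X$ into compact Hausdorff spaces extend continuously to $\beta X$. $K(\beta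 X)$ is the smallest two-sided ideal, and $D\subseteq X$ is piecewise syndetic if $D\in p$ for some $p\in K(\beta X)$. *)

(* Defs.v *)
From HB Require Import structures.
From mathcomp Require Import all_boot.
From mathcomp Require Import mathcomp_extra boolp classical_sets functions.
From mathcomp Require Import cardinality filter topology.

Set Implicit Arguments.
Unset Strict Implicit.
Unset Printing Implicit Defensive.

Local Open Scope classical_set_scope.
Local Open Scope group_scope.

Section Words.
Variable A : finType.

Definition word := {s : seq A | s != [::]}.

HB.instance Definition _ := Choice.on word.

Fact cat_word_subproof (u v : word) : val u ++ val v != [::].
Proof. by case: u => -[]. Qed.

Definition cat_word (u v : word) : word :=
  exist _ (val u ++ val v) (cat_word_subproof u v).

Fact cat_wordA : associative cat_word.
Proof. by move=> u v w; apply/val_inj; rewrite /= catA. Qed.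

HB.instance Definition _ := isSemigroup.Build word cat_wordA.

Section VariableWords.
Variable n : nat.

(* [inl a] is the letter a; [inr i] is the variable v_(i+1). *)
Definition is_vword (w : seq (A + 'I_n)) :=
  (w != [::]) && [forall i : 'I_n, inr i \in w].

Definition vword := {w : seq (A + 'I_n) | is_vword w}.

HB.instance Definition _ := Choice.on vword.

Fact is_vword_cat (x y : seq (A + 'I_n)) (w : vword) :
  is_vword (x ++ val w ++ y).
Proof.
case: w => w /= /andP[wn0 /forallP wv]; apply/andP; split.
  by case: x => //; case: w wn0 {wv}.
by apply/forallP => i; rewrite !mem_cat wv orbT.
Qed.

Fact cat_vword_subproof (v w : vword) : is_vword (val v ++ val w).
Proof. exact: (is_vword_cat [::]). Qed.

Definition cat_vword (v w : vword) : vword :=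
  exist _ (val v ++ val w) (cat_vword_subproof v w).

Fact cat_vwordA : associative cat_vword.
Proof. by move=> u v w; apply/val_inj; rewrite /= catA. Qed.

HB.instance Definition _ := isSemigroup.Build vword cat_vwordA.

(* The word u of S_0 read over the larger alphabet of S_n. *)
Definition letters (u : word) : seq (A + 'I_n) := map inl (val u).

Fact lcat_subproof (u : word) (w : vword) : is_vword (letters u ++ val w).
Proof. by rewrite -[val w]cats0 is_vword_cat. Qed.

Definition lcat (u : word) (w : vword) : vword :=
  exist _ (letters u ++ val w) (lcat_subproof u w).

Fact rcat_subproof (w : vword) (u : word) : is_vword (val w ++ letters u).
Proof. exact: (is_vword_cat [::]). Qed.

Definition rcat (w : vword) (u : word) : vword :=
  exist _ (val w ++ letters u) (rcat_subproof w u).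

Definition S0_independent (C : Type) (phi : vword -> C) :=
  forall u w, phi (lcat u w) = phi w /\ phi (rcat w u) = phi w.

Definition S0_preserving (nu : vword -> word) :=
  forall u w, nu (lcat u w) = u * nu w /\ nu (rcat w u) = nu w * u.

End VariableWords.
End Words.

HB.mixin Record isRightTopological C of Topological C & Semigroup C := {
  rtrans_continuous : forall s : C, continuous (fun x : C => x * s)
}.

#[short(type="rightTopologicalSemigroupType")]
HB.structure Definition RightTopologicalSemigroup :=
  {C of Topological C & Semigroup C & isRightTopological C}.

Definition topological_center (C : rightTopologicalSemigroupType) : set C :=
  [set s | continuous (fun x : C => s * x)].
Arguments topological_center : clear implicits.

(* Semigroups are nonempty, as usual in this subject. *)
Definition subsemigroup (C : semigroupType) (P : set C) :=
  P !=set0 /\ (forall p q, P p -> P q -> P (p * q)).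

(* Ideals are nonempty: otherwise the smallest one would be empty. *)
Definition two_sided_ideal (C : semigroupType) (I : set C) :=
  I !=set0 /\ (forall x y, I x -> I (x * y) /\ I (y * x)).

Definition smallest_ideal (C : semigroupType) : set C :=
  smallest (@two_sided_ideal C) set0.
Arguments smallest_ideal : clear implicits.

(* Stone-Cech compactification of the discrete space X: its points are the
   ultrafilters on X, and the sets [beta_open A] are a base of its topology. *)
Record beta (X : Type) := Beta {
  beta_sets :> set X -> Prop;
  beta_ultra : UltraFilter beta_sets
}.
#[global] Existing Instance beta_ultra.

HB.instance Definition _ (X : Type) := gen_eqMixin (beta X).
HB.instance Definition _ (X : Type) := gen_choiceMixin (beta X).

Lemma betaP (X : Type) (p q : beta X) : (forall A : set X, p A <-> q A) -> p = q.
Proof.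
case: p q => p pU [q qU] /= pq.
have e : p = q by apply/predeqP => A; exact: pq.
by case: _ / e in qU *; rewrite (Prop_irrelevance pU qU).
Qed.

Definition beta_principal (X : Type) (x : X) : beta X :=
  Beta (principal_filter_ultra x).

Definition beta_open (X : Type) (A : set X) : set (beta X) := [set p | p A].

Section BetaTopology.
Variable X : Type.

Fact beta_open_cover : \bigcup_(A in setT) @beta_open X A = setT.
Proof. by apply/seteqP; split => // p _; exists setT => //; exact: filterT. Qed.

Fact beta_open_join (A B : set X) (p : beta X) : setT A -> setT B ->
  beta_open A p -> beta_open B p ->
  exists D, [/\ setT D, beta_open D p &
                beta_open D `<=` beta_open A `&` beta_open B].
Proof.
move=> _ _ pA pB; exists (A `&` B); split=> //; rewrite /beta_open/=; first exact: filterI.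
by move=> q qAB; split; apply: filterS qAB => x [].
Qed.

HB.instance Definition _ :=
  isBaseTopological.Build (beta X) beta_open_cover beta_open_join.

Lemma open_beta_open (A : set X) : open (beta_open A).
Proof. by exists [set A] => //; rewrite bigcup_set1. Qed.

Lemma beta_nbhsP (p : beta X) (U : set (beta X)) :
  nbhs p U <-> exists2 A, p A & beta_open A `<=` U.
Proof.
split=> [|[A pA AU]]; last first.
  by apply: filterS AU _; apply: open_nbhs_nbhs; split => //; exact: open_beta_open.
rewrite nbhsE => -[V [[D _ <-] [A DA pA]] VU].
by exists A => // q qA; apply: VU; exists A.
Qed.

End BetaTopology.

Lemma ultraP (X : Type) (F : set_system X) : ProperFilter F ->
  (forall A, F A \/ F (~` A)) -> UltraFilter F.
Proof.
move=> FF FC; split=> // G GF FG; apply/seteqP; split => // A GA.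
have [//|/FG GnA] := FC A.
by have [x []] := filter_ex (filterI GA GnA).
Qed.

Section BetaSemigroup.
Variable X : semigroupType.

Definition beta_mul_sets (p q : beta X) : set_system X :=
  [set A | p [set x | q [set y | A (x * y)]]].

Fact beta_mul_ultra (p q : beta X) : UltraFilter (beta_mul_sets p q).
Proof.
apply: ultraP => [|A]; rewrite /beta_mul_sets/=.
  apply: Build_ProperFilter_ex.
    move=> A /= pqA; have [x qA] := filter_ex pqA.
    by have [y Axy] := filter_ex qA; exists (x * y).
  split.
  - by apply: (@filterE _ p) => x; exact: (@filterE _ q).
  - move=> A B pA pB; apply: (@filterS _ p _ _ _ _ (@filterI _ p _ _ _ pA pB)) => x.
    by case=> qA qB; exact: (@filterI _ q).
  - move=> A B AB; apply: (@filterS _ p) => x; apply: (@filterS _ q) => y.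
    exact: AB.
have [pA|pA] := in_ultra_setVsetC [set x | q [set y | A (x * y)]] (beta_ultra p).
  by left.
right; apply: filterS pA => x /= nqA.
by have [//|] := in_ultra_setVsetC [set y | A (x * y)] (beta_ultra q).
Qed.

Definition beta_mul (p q : beta X) : beta X := Beta (beta_mul_ultra p q).

Fact beta_mulA : associative beta_mul.
Proof.
move=> p q r; apply: betaP => A; rewrite /= /beta_mul_sets /=.
suff -> : [set x | q [set y | r [set z | A (x * (y * z))]]] =
          [set x | q [set y | r [set z | A (x * y * z)]]] by [].
by under eq_set do under eq_set do under eq_set do rewrite mulgA.
Qed.

HB.instance Definition _ := isSemigroup.Build (beta X) beta_mulA.

Fact beta_rtrans_continuous (q : beta X) : continuous (fun p : beta X => p * q).
Proof.
move=> p U /beta_nbhsP[A pqA AU]; apply/beta_nbhsP.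
by exists [set x | q [set y | A (x * y)]] => // p' p'A; exact: AU.
Qed.

HB.instance Definition _ :=
  isRightTopological.Build (beta X) beta_rtrans_continuous.

End BetaSemigroup.

Definition piecewise_syndetic (X : semigroupType) (D : set X) :=
  exists2 p : beta X, smallest_ideal _ p & p D.

Definition continuous_extension (X : Type) (C : topologicalType)
    (f : X -> C) (g : beta X -> C) :=
  continuous g /\ (forall x, g (beta_principal x) = f x).

Lemma continuous_extension_exists (X : Type) (C : topologicalType)
    (f : X -> C) : compact [set: C] -> hausdorff_space C ->
  exists g : beta X -> C, continuous_extension f g.
Proof.
move=> cC hC.
have fU (p : beta X) : UltraFilter (fmap f (beta_sets p)).
  by apply: ultraP => A; exact: in_ultra_setVsetC (beta_ultra p).
have fcv (p : beta X) : exists c : C, fmap f (beta_sets p) --> c.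
  have := cC; rewrite compact_ultra => /(_ _ (fU p) filterT) [c [_ fc]].
  by exists c.
have [g gP] := choice fcv.
exists g; split=> [p U /= gU|x]; last first.
  apply: (cvg_unique hC (gP _)).
  by move=> V fV; apply/principal_filterP; exact: nbhs_singleton.
have [V gV VU] : filter_from (nbhs (g p)) closure U.
  exact: (compact_regular hC cC filterT).
apply/beta_nbhsP; exists (f @^-1` V); first exact: gP.
move=> q qV; apply: VU => W gqW.
have qW := gP q _ gqW.
have [x [Vx Wx]] := filter_ex (@filterI _ q _ _ _ qV qW).
by exists (f x).
Qed.

(* Main.v *)
(** Let [phi(t) = e] be idempotent and let [D] belong to a point [p] of the
    smallest ideal, so that [p] generates a minimal left ideal [L] of [beta S_0].
    Multiplying on the right by [p] does not change [phi(t)], and it puts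
    every [nu(t)] into [L]; hence the [t] with
    [phi(t) = e] and all [nu(t)] in [L] form a nonempty closed semigroup, which
    contains an idempotent [t].  Then [nu(t)] is an idempotent of [L], so
    [p nu(t) = p], and [D] contains [u nu(w) = nu(u w)] for some letters-only [u]
    and [t]-many [w]; [phi(u w) = phi(w)] is near [e].
    For products, write [p = y p] with [y] in the smallest ideal: the [x] with
    [x^-1 D] in [p] form a member of [y], hence a piecewise syndetic set, so one
    can choose the two factors successively. *)
Require Import Defs.
From mathcomp Require Import all_boot.
From mathcomp Require Import boolp classical_sets functions cardinality filter.
From mathcomp Require Import topology.

Local Open Scope classical_set_scope.
Local Open Scope group_scope.

(** * Minimal closed sets and idempotents in compact spaces *)

Lemma chain_bigcap_nonempty (X : topologicalType) (F : set (set X)) :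
  compact [set: X] -> F !=set0 -> total_on F subset ->
  (forall A, F A -> closed A /\ A !=set0) -> \bigcap_(A in F) A !=set0.
Proof.
move=> cX [A0 FA0] totF FP.
have FF : ProperFilter (filter_from F id).
  apply: filter_from_proper; last by move=> A /FP[].
  apply: filter_from_filter; first by exists A0.
  move=> A B FA FB; have [AB|BA] := totF _ _ FA FB.
    by exists A => // x Ax; split=> //; exact: AB.
  by exists B => // x Bx; split=> //; exact: BA.
have [x [_ xF]] := cX _ FF filterT.
exists x => A FA; have [clA _] := FP _ FA.
by apply: clA => B xB; apply: xF xB; exists A.
Qed.

(** Zorn's lemma below [T]. [Q] is left abstract because it serves twice: for closed subsemigroups
    and for closed left ideals. *)
Lemma minimal_closed_set (X : topologicalType) (Q : set (set X)) (T : set X) :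
  compact [set: X] -> (forall A, Q A -> closed A) ->
  (forall F, F `<=` Q -> Q (\bigcap_(A in F) A)) -> Q T -> T !=set0 ->
  exists M, [/\ Q M, M !=set0, M `<=` T &
    forall A, Q A -> A !=set0 -> A `<=` M -> A = M].
Proof.
move=> cX Qcl QI QT T0.
have QI2 A B : Q A -> Q B -> Q (A `&` B).
  move=> QA QB; have -> : A `&` B = \bigcap_(D in [set A; B]) D.
    by rewrite bigcap_setU !bigcap_set1.
  by apply: QI => D [->|->].
have [F FP totF|B [[QB [z [Bz Tz]]] Bmax]] :=
    @Zorn_bigcup X [set B | Q (~` B) /\ ~` B `&` T !=set0].
  split.
    rewrite setC_bigcup -(bigcap_image F (@setC X) id); apply: QI => _ [B FB <-].
    by have [] := FP _ FB.
  have [F0|/set0P/negP/negPn/eqP->] := pselect (F !=set0); last first.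
    by rewrite bigcup_set0 setC0 setTI.
  have [|||x xF] := @chain_bigcap_nonempty X [set ~` B `&` T | B in F] cX.
  - by have [B FB] := F0; exists (~` B `&` T), B.
  - move=> _ _ [B FB <-] [D FD <-]; have [BD|DB] := totF _ _ FB FD.
      by right; apply: setSI; exact: subsetC.
    by left; apply: setSI; exact: subsetC.
  - move=> _ [B FB <-]; have [QB BT] := FP _ FB; split=> //.
    by apply: Qcl; exact: QI2.
  exists x; split; last first.
    by have [B FB] := F0; have [] := xF _ (imageP (fun B => ~` B `&` T) FB).
  by move=> [B FB]; have [] := xF _ (imageP (fun B => ~` B `&` T) FB).
exists (~` B `&` T); split; [exact: QI2|by exists z|by move=> ? []|].
move=> A QA [a Aa] AM; apply/seteqP; split=> // x [Bx Tx].
apply: contrapT => nAx.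
apply: (Bmax (~` A)) => /=.
  split; first by move=> y By /AM[].
  by move=> /(_ x nAx).
by rewrite setCK; split=> //; exists a; split=> //; have [] := AM _ Aa.
Qed.

Lemma closed_image (X Y : topologicalType) (f : X -> Y) (A : set X) :
  compact A -> hausdorff_space Y -> continuous f -> closed (f @` A).
Proof.
move=> cA hY cf; apply: compact_closed hY _; apply: continuous_compact cA.
exact: continuous_subspaceT.
Qed.

(** Ellis-Numakura: in a minimal closed subsemigroup [M] with [x] in [M], minimality gives
    [M x = M], so some [y] in [M] satisfies [y x = x]. Such [y] form a closed subsemigroup, hence
    all of [M], which contains [x]. *)
Lemma idempotent_exists (C : rightTopologicalSemigroupType) (T : set C) :
  compact [set: C] -> hausdorff_space C -> closed T -> subsemigroup T ->
  exists2 e, T e & e * e = e.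
Proof.
move=> cC hC clT [T0 TM].
pose Q := [set A : set C | closed A /\ forall x y, A x -> A y -> A (x * y)].
have [| | | //|M [[clM MM] [x Mx] MT Mmin]] := @minimal_closed_set C Q T cC.
- by move=> A [].
- move=> F FQ; split; first by apply: closed_bigI => A /FQ[].
  by move=> x y Fx Fy A FA; apply: (FQ _ FA).2; [exact: Fx|exact: Fy].
- by [].
have clx A : closed A -> closed [set y * x | y in A].
  move=> clA; apply: closed_image hC _; last exact: rtrans_continuous.
  by rewrite -[A]setTI; exact: compact_closedI.
have Mx_M : [set y * x | y in M] = M.
  apply: Mmin => [||_ [y My <-]]; last exact: MM.
    split; first exact: clx.
    move=> _ _ [y My <-] [z Mz <-]; exists (y * x * z); last by rewrite mulgA.
    by apply: (MM) => //; exact: MM.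
  by exists (x * x), x.
pose N := M `&` [set y | y * x = x].
suff NM : N = M by exists x; [exact: MT|have [] : N x by rewrite NM].
apply: Mmin; last by move=> ? [].
  split.
    apply: closedI => //.
    apply: (@preimage_closed _ _ (fun y : C => y * x) [set x]).
      by move=> y _; exact: rtrans_continuous.
    exact: accessible_closed_set1 (hausdorff_accessible hC) _.
  by move=> y z [My yx] [Mz zx]; split; [exact: MM|rewrite /= -mulgA zx].
by have : M x by []; rewrite -{1}Mx_M => -[y My yx]; exists y.
Qed.

(** * Topology of [beta X] and continuous extensions *)

Lemma beta_compact (X : Type) : compact [set: beta X].
Proof.
rewrite compact_ultra => G GU _.
have pU : UltraFilter [set A : set X | G (beta_open A)].
  apply: ultraP => [|A].
    apply: Build_ProperFilter_ex.
      move=> A GA; have [q qA] := @filter_ex _ G _ _ GA.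
      exact: @filter_ex _ q _ _ qA.
    split.
    - by apply: (@filterE _ G) => q; exact: (@filterT _ q).
    - by move=> A B GA GB; apply: filterS (@filterI _ G _ _ _ GA GB) => q [? ?];
        exact: (@filterI _ q).
    - by move=> A B AB; apply: (@filterS _ G) => q; exact: (@filterS _ q).
  have [GA|GA] := in_ultra_setVsetC (beta_open A) GU; [by left|right].
  apply: filterS GA => q nqA.
  by have [] := in_ultra_setVsetC A (beta_ultra q).
exists (Beta pU); split=> // U /beta_nbhsP[A GA AU].
exact: filterS AU GA.
Qed.

Lemma beta_hausdorff (X : Type) : hausdorff_space (beta X).
Proof.
move=> p q pq.
have sub A : p A -> q A.
  move=> pA; have [//|qA] := in_ultra_setVsetC A (beta_ultra q).
  have [||r [rA nrA]] := pq (beta_open A) (beta_open (~` A)).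
  - by apply/beta_nbhsP; exists A.
  - by apply/beta_nbhsP; exists (~` A).
  by have [x []] := filter_ex (@filterI _ r _ _ _ rA nrA).
apply: betaP => A; split; first exact: sub.
move=> qA; have [//|/sub nqA] := in_ultra_setVsetC A (beta_ultra p).
by have [x []] := filter_ex (@filterI _ q _ _ _ qA nqA).
Qed.

Lemma beta_principalP (X : Type) (x : X) (A : set X) :
  beta_sets (beta_principal x) A = A x.
Proof. by apply/propext; exact: principal_filterP. Qed.

(** The principal ultrafilters are dense, since members of an ultrafilter are nonempty. *)
Lemma beta_continuous_eq (X : Type) (C : topologicalType) (f g : beta X -> C) :
  hausdorff_space C -> continuous f -> continuous g ->
  (forall x, f (beta_principal x) = g (beta_principal x)) -> f = g.
Proof.
move=> hC cf cg fg; apply/funext => p; apply: hC => U V /cf pU /cg pV.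
have /beta_nbhsP[A pA AU] := pU; have /beta_nbhsP[B pB BV] := pV.
have [x [Ax Bx]] := filter_ex (@filterI _ p _ _ _ pA pB).
exists (f (beta_principal x)); split; first by apply: AU; exact/principal_filterP.
by rewrite fg; apply: BV; exact/principal_filterP.
Qed.

Lemma continuous_extension_nbhs (X : Type) (C : topologicalType) (f : X -> C)
    (g : beta X -> C) (p : beta X) (U : set C) :
  continuous_extension f g -> nbhs (g p) U -> p (f @^-1` U).
Proof.
move=> [cg gf] /cg gU; have /beta_nbhsP[A pA AU] := gU.
apply: filterS pA => x Ax; rewrite /preimage /= -gf.
by apply: AU; exact/principal_filterP.
Qed.

Section BetaMap.
Variables (X Y : Type) (f : X -> Y).

Fact beta_map_ultra (p : beta X) : UltraFilter [set A | p (f @^-1` A)].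
Proof.
by apply: ultraP => A; exact: in_ultra_setVsetC (beta_ultra p).
Qed.

(** The pushforward of ultrafilters, which is the continuous extension of [f]. *)
Definition beta_map (p : beta X) : beta Y := Beta (beta_map_ultra p).

Lemma beta_map_continuous : continuous beta_map.
Proof.
move=> p U /beta_nbhsP[A pA AU]; apply/beta_nbhsP.
by exists (f @^-1` A) => // q qA; exact: AU.
Qed.

Lemma beta_map_principal x :
  beta_map (beta_principal x) = beta_principal (f x).
Proof.
apply: betaP => A; rewrite beta_principalP.
have -> : beta_sets (beta_map (beta_principal x)) A = A (f x).
  exact: beta_principalP x (f @^-1` A).
by [].
Qed.

End BetaMap.
Arguments beta_map {X Y} f p.

(** * Multiplication on [beta X]: extended homomorphisms and the smallest ideal *)

Lemma beta_principal_mul (X : semigroupType) (x : X) (q : beta X) :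
  beta_principal x * q = beta_map (fun y => x * y) q.
Proof.
apply: betaP => A.
have -> : beta_sets (beta_principal x * q) A = q [set y | A (x * y)].
  exact: beta_principalP x [set z : X | q [set y : X | A (z * y)]].
by [].
Qed.

Lemma beta_mul_principal (X : semigroupType) (x y : X) :
  beta_principal x * beta_principal y = beta_principal (x * y).
Proof. by rewrite beta_principal_mul beta_map_principal. Qed.

(** Density is used in the left factor first, then in the right one. In the second round the left
    factor is principal, and left translation by [f x] is continuous because [f x] is in the
    topological center. *)
Lemma continuous_extension_mul (X : semigroupType)
    (C : rightTopologicalSemigroupType) (f : {multiplicative X -> C})
    (g : beta X -> C) : hausdorff_space C ->
  range f `<=` topological_center C -> continuous_extension f g ->
  {morph g : p q / p * q}.
Proof.
move=> hC fC [cg gf] p q.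
suff : (fun p => g (p * q)) = (fun p => g p * g q) by move/(congr1 (@^~ p)).
apply: beta_continuous_eq => // [r|r|x].
- by apply: (@continuous_comp _ _ _ (fun p : beta X => p * q));
    [exact: rtrans_continuous|exact: cg].
- by apply: (@continuous_comp _ _ _ g (fun x : C => x * g q));
    [exact: cg|exact: rtrans_continuous].
rewrite gf.
suff : (fun q => g (beta_principal x * q)) = (fun q => f x * g q).
  by move/(congr1 (@^~ q)).
apply: beta_continuous_eq => // [r|r|y].
- under eq_fun do rewrite beta_principal_mul.
  by apply: (@continuous_comp _ _ _ _ g); [exact: beta_map_continuous|exact: cg].
- by apply: (@continuous_comp _ _ _ g); [exact: cg|apply: fC; exists x].
by rewrite beta_mul_principal !gf gmulfM.
Qed.

Lemma beta_map_mul (X Y : semigroupType) (f : {multiplicative X -> Y}) :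
  {morph beta_map f : p q / p * q}.
Proof.
move=> p q; apply: betaP => A.
suff -> : beta_sets (beta_map f (p * q)) A =
  p [set x | q [set y | A (f x * f y)]] by [].
have -> : beta_sets (beta_map f (p * q)) A =
  p [set x | q [set y | A (f (x * y))]] by [].
by under eq_set do under eq_set do rewrite gmulfM.
Qed.

(* The left ideal generated by a point of the smallest ideal is minimal. *)
Lemma smallest_ideal_absorb (X : semigroupType) (p x : beta X) :
  smallest_ideal _ p -> exists y, y * (x * p) = p.
Proof.
move=> Kp.
pose Q := [set L : set (beta X) | closed L /\ forall y z, L z -> L (y * z)].
have [| | | |L [[_ LM] [l Ll] _ Lmin]] :=
    @minimal_closed_set (beta X) Q setT (@beta_compact X).
- by move=> L [].
- move=> F FQ; split; first by apply: closed_bigI => L /FQ[].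
  by move=> y z Fz L FL; apply: (FQ _ FL).2; exact: Fz.
- by split=> //; exact: closedT.
- by exists p.
have LE z : L z -> range (fun y => y * z) = L.
  move=> Lz; apply: Lmin => [||_ [y _ <-]]; [|by exists (z * z), z|exact: LM].
  split; last by move=> y _ [w _ <-]; exists (y * w) => //; rewrite mulgA.
  apply: closed_image; [exact: beta_compact|exact: beta_hausdorff|].
  exact: rtrans_continuous.
(* The ideal generated by the minimal left ideal [L] contains [p], so [p = k z] with [k] in [L].
   Since [x k] generates [L], it can be carried back to [k], and multiplying by [z] gives the
   claim. *)
pose I := [set k * z | k in L & z in [set: beta X]].
have idI : two_sided_ideal I.
  split=> [|_ y [k Lk [z _ <-]]]; first by exists (l * l), l => //; exists l.
  split; first by exists k => //; exists (z * y); rewrite ?mulgA.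
  by exists (y * k); [exact: LM|exists z => //; rewrite mulgA].
have [k Lk [z _ <-]] : I p by apply: (Kp I); split.
have [y _ yk] : range (fun y => y * (x * k)) k by rewrite LE //; exact: LM.
by exists y; rewrite !mulgA -(mulgA y) yk.
Qed.

Lemma smallest_ideal_mul (X : semigroupType) (p x : beta X) :
  smallest_ideal _ p -> smallest_ideal _ (x * p).
Proof.
move=> Kp I idI; have [[_ IM] _] := idI.
by have [] := IM p x (Kp _ idI).
Qed.

Lemma ultra_finite_bigcap (X I : Type) (p : beta X) (F : set I)
    (D : I -> set X) :
  finite_set F -> (forall i, F i -> p (D i)) -> p (\bigcap_(i in F) D i).
Proof.
elim/Pchoice: I => I in F D *.
move=> /finite_fsetP[E ->] pD.
by apply: (@filter_bigI _ _ _ _ p) => i iE; exact: pD.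
Qed.

(** * Words with variables and the theorem *)

Lemma vword_inhabited (A : finType) (n : nat) :
  (0 < #|A|)%N -> exists w : vword A n, True.
Proof.
move=> /card_gt0P[a _].
(* The leading letter keeps the word nonempty when [n = 0]. *)
have vw : is_vword (inl a :: [seq inr i | i : 'I_n]).
  apply/andP; split=> //; apply/forallP => i.
  by rewrite inE map_f ?orbT// mem_enum.
by exists (exist (fun w => is_vword w) _ vw).
Qed.

(* [t'] is the product [t * p] computed in the Stone-Cech compactification of
   the semigroup of all words over the letters and the variables. *)
Lemma beta_right_translate (A : finType) (n : nat) (C : topologicalType)
    (phi : vword A n -> C) (phib : beta (vword A n) -> C)
    (t : beta (vword A n)) (p : beta (word A)) :
  hausdorff_space C -> S0_independent phi -> continuous_extension phi phib ->
  exists t', phib t' = phib t /\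
    forall nu : vword A n -> word A, S0_preserving nu ->
      beta_map nu t' = beta_map nu t * p.
Proof.
move=> hC phi_ind [cphib phibE].
(* [g] extends [w |-> w p], the limit of the words [w u] as [u] tends to [p]. *)
have [g [cg gE]] := continuous_extension_exists
  (fun w => beta_map (rcat w) p) (@beta_compact (vword A n)) (@beta_hausdorff _).
exists (g t); split.
  suff : phib \o g = phib by move/(congr1 (@^~ t)).
  apply: (beta_continuous_eq _ _ _ _ hC) => // [q|w].
    by apply: continuous_comp; [exact: cg|exact: cphib].
  rewrite /= gE.
  suff : phib \o beta_map (rcat w) = cst (phi w).
    by move/(congr1 (@^~ p)) => /= ->; rewrite phibE.
  apply: (beta_continuous_eq _ _ _ _ hC) => [q|q|u].
  - by apply: continuous_comp; [exact: beta_map_continuous|exact: cphib].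
  - exact: cst_continuous.
  - by rewrite /= beta_map_principal phibE; have [] := phi_ind u w.
move=> nu nuP.
suff : beta_map nu \o g = (fun q => beta_map nu q * p) by move/(congr1 (@^~ t)).
apply: (beta_continuous_eq _ _ _ _ (@beta_hausdorff _)) => [q|q|w].
- by apply: continuous_comp; [exact: cg|exact: beta_map_continuous].
- by apply: (@continuous_comp _ _ _ (beta_map nu) (fun r => r * p));
    [exact: beta_map_continuous|exact: rtrans_continuous].
rewrite /= gE beta_map_principal beta_principal_mul.
suff <- : nu \o rcat w = (fun u => nu w * u) by exact: betaP.
by apply/funext => u; have [] := nuP u w.
Qed.

Lemma idempotent_preserving_words (A : finType) (n : nat)
    (C : rightTopologicalSemigroupType) (phi : {multiplicative vword A n -> C})
    (phib : beta (vword A n) -> C)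
    (F : set {multiplicative vword A n -> word A}) (e : C)
    (U : set C) (D : set (word A)) :
  hausdorff_space C -> S0_independent phi ->
  range phi `<=` topological_center C -> continuous_extension phi phib ->
  finite_set F -> (forall nu, F nu -> S0_preserving nu) ->
  range phib e -> e * e = e -> nbhs e U -> piecewise_syndetic D ->
  exists w : vword A n, U (phi w) /\ forall nu, F nu -> D (nu w).
Proof.
move=> hC phi_ind phi_center phibE finF FP [t0 _ t0e] ee eU [p Kp pD].
pose T := phib @^-1` [set e] `&`
  \bigcap_(nu in F) (beta_map nu @^-1` range (fun q => q * p)).
have [||t [te tF] tt] :=
    @idempotent_exists _ T (@beta_compact _) (@beta_hausdorff _).
- apply: closedI.
    apply: preimage_closed; first by move=> q _; exact: phibE.1.
    exact: accessible_closed_set1 (hausdorff_accessible hC) _.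
  apply: closed_bigI => nu _; apply: preimage_closed.
    by move=> q _; exact: beta_map_continuous.
  apply: closed_image; [exact: beta_compact|exact: beta_hausdorff|].
  exact: rtrans_continuous.
- split.
    have [t1 [t1e t1F]] := beta_right_translate _ _ _ _ _ t0 p hC phi_ind phibE.
    exists t1; split; first by rewrite /= t1e.
    by move=> nu /FP/t1F; rewrite /preimage /= => ->; exists (beta_map nu t0).
  move=> q r [qe qF] [re rF]; split.
    by rewrite /= (continuous_extension_mul _ _ _ _ hC phi_center phibE) qe re.
  move=> nu Fnu; have [y _ yE] := rF _ Fnu.
  by rewrite /preimage /= beta_map_mul -yE mulgA; exists (beta_map nu q * y).
(* Each [nu(t)] is an idempotent of the minimal left ideal generated by [p],
   hence a right identity of that ideal. *)
have pt nu : F nu -> p * beta_map nu t = p.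
  move=> Fnu; have [x _ xE] := tF _ Fnu.
  have [y yE] := smallest_ideal_absorb _ _ x Kp.
  by rewrite -[in LHS]yE xE -mulgA -beta_map_mul tt -xE.
(* This unfolds [D] being in [p nu(t)]; as [F] is finite, one [u] serves every [nu]. *)
have : p (\bigcap_(nu in F) [set u | t [set w | D (u * nu w)]]).
  by apply: ultra_finite_bigcap => // nu Fnu; move: pD; rewrite -{1}(pt _ Fnu).
move=> /(@filter_ex _ p)[u uP].
have tD : t (\bigcap_(nu in F) [set w | D (u * nu w)]) by exact: ultra_finite_bigcap.
have tU : t (phi @^-1` U) by apply: continuous_extension_nbhs phibE _; rewrite te.
have [w [Uw Dw]] := filter_ex (@filterI _ t _ _ _ tU tD).
exists (lcat u w); split; first by have [-> _] := phi_ind u w.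
by move=> nu Fnu; have [-> _] := FP _ Fnu u w; exact: Dw.
Qed.

Theorem theorem4p1 (A : finType) (A_nonempty : (0 < #|A|)%N) (n : nat)
    (C : rightTopologicalSemigroupType)
    (C_compact : compact [set: C]) (C_hausdorff : hausdorff_space C)
    (phi : {multiplicative vword A n -> C})
    (phi_independent : S0_independent phi)
    (phi_center : range phi `<=` topological_center C)
    (phib : beta (vword A n) -> C)
    (phib_extends : continuous_extension phi phib)
    (F : set {multiplicative vword A n -> word A})
    (F_finite : finite_set F) (F_nonempty : F !=set0)
    (F_preserving : forall nu, F nu -> S0_preserving nu) :
  let P : set C :=
    [set p | range phib p /\
      forall (U : set C) (D : set (word A)), nbhs p U -> piecewise_syndetic D ->
        exists w : vword A n, U (phi w) /\ forall nu, F nu -> D (nu w)] in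
  [/\ compact P, subsemigroup P &
      forall e : C, range phib e -> e * e = e -> P e].
Proof.
move=> P.
have Pidem e : range phib e -> e * e = e -> P e.
  move=> re ee; split=> // U D eU pwD.
  exact: (@idempotent_preserving_words _ _ _ phi phib F e).
have phibM :=
  continuous_extension_mul _ _ _ _ C_hausdorff phi_center phib_extends.
split=> //.
  have clP : closed P.
    move=> c cP; split.
      have [cphib _] := phib_extends.
      apply: (closed_image _ _ phib setT (@beta_compact _) C_hausdorff cphib).
      by move=> V /cP[p [[rp _] Vp]]; exists p.
    move=> U D; rewrite nbhsE => -[V [oV Vc] VU] pwD.
    (* The open [V] is also a neighborhood of any point of [P] inside it. *)
    have [|p [[_ pP] Vp]] := cP V; first exact: open_nbhs_nbhs.
    have [|w [Vw Dw]] := pP V D _ pwD; first exact: open_nbhs_nbhs.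
    by exists w; split=> //; exact: VU.
  by rewrite -[P]setTI; exact: compact_closedI.
split.
  have [w _] := vword_inhabited A n A_nonempty.
  have [||t _ tt] := @idempotent_exists (beta (vword A n)) setT
      (@beta_compact _) (@beta_hausdorff _).
  - exact: closedT.
  - by split=> //; exists (beta_principal w).
  by exists (phib t); apply: Pidem; [exists t|rewrite -phibM tt].
move=> p q [[s _ sp] pP] [[t _ tq] qP]; split.
  by exists (s * t) => //; rewrite phibM sp tq.
move=> U D; rewrite nbhsE => -[V [oV Vpq] VU] [r Kr rD].
(* Absorbing [r] itself gives [y r r = r], with left factor [y r] again in the smallest ideal. *)
have [y yr] := smallest_ideal_absorb _ _ r Kr.
have pwE : piecewise_syndetic [set x | r [set z | D (x * z)]].
  by exists (y * r); [exact: smallest_ideal_mul|move: rD; rewrite -{1}yr mulgA].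
have [|w1 [Vw1 Ew1]] := pP (fun x => V (x * q)) _ _ pwE.
  by apply: rtrans_continuous; exact: open_nbhs_nbhs.
(* [w2] is chosen after [w1]: [phi w1] being in the center makes the first set a neighborhood of
   [q], and the second is piecewise syndetic as a member of [r]. *)
have [||w2 [Vw2 Dw2]] := qP (fun x => V (phi w1 * x))
    (\bigcap_(nu in F) [set z | D (nu w1 * z)]).
- by apply: phi_center; [exists w1|exact: open_nbhs_nbhs].
- by exists r => //; exact: ultra_finite_bigcap.
exists (w1 * w2); split; first by apply: VU; rewrite gmulfM.
by move=> nu Fnu; rewrite gmulfM; exact: Dw2.
Qed.
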